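(* Let $p$ be a prime, $q$ a prime power, $l$ a positive integer with $\gcd(p,l)=\gcd(p,q)=1$, and let $C$ and $C'$ be two quasi-cyclic codes of order $l$ and length $n=p^rl$ over $\mathbb{F}_q$. Let $P$ be a Sylow $p$-subgroup of $Per(C)$ such that $T^l\in P$. If $C$ and $C'$ are equivalent, then they are equivalent by an element of the set $$H'(P)=\{\sigma\in S_n : \sigma^{-1}T^l\sigma\in P\},$$ i.e. there is $\sigma\in H'(P)$ with $C'=\sigma(C)$.
   Context: Coordinates of a code of length $n$ are indexed by $\mathbb{Z}/n\mathbb{Z}$. For a linear code $C$ and a permutation $\sigma$ of the coordinates, $\sigma(C)=\{(x_{\sigma^{-1}(i)})_i : (x_i)_i\in C\}$, and $Per(C)=\{\sigma\in S_n:\sigma(C)=C\}$. Codes $C,C'$ are equivalent (by $\sigma$) if $C'=\sigma(C)$ for some $\sigma\in S_n$. With $T:i\mapsto i+1\bmod n$, a linear code $C$ of length $n=lm$ is quasi-cyclic of order $l$ if it is invariant under $T^l:i\mapsto i+l\bmod n$, i.e. $T^l\in Per(C)$. Permutations are composed as functions. *)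

(* Defs.v *)
From mathcomp Require Export all_boot all_order all_algebra all_fingroup all_solvable all_field.

Set Implicit Arguments.
Unset Strict Implicit.
Unset Printing Implicit Defensive.

Import GroupScope GRing.Theory.

(* MathComp composes permutations left to right: (s * t) i = t (s i).
   A product of functions "s o t" is therefore written t * s below. *)

Section Codes.

Variables (F : finFieldType) (n : nat).
Implicit Types (C : {vspace 'rV[F]_n}) (s t : 'S_n).

(* Coordinates are indexed by 'I_n rather than 'Z_n, since 'Z_1 has two
   elements; ordS is i |-> i + 1 mod n. *)
Definition shift : 'S_n := perm (@ordS_inj n).

(* Since (col_perm s x) 0 i = x 0 (s i), this is the set of all
   (x_(s^-1 i))_i for x in C; see perm_codeP. *)
Definition perm_code s C : {vspace 'rV[F]_n} :=
  (linfun (col_perm s^-1) @: C)%VS.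

Lemma perm_codeP s C (y : 'rV[F]_n) :
  reflect (exists2 x, x \in C & forall i, y ord0 i = x ord0 (s^-1 i))
          (y \in perm_code s C).
Proof.
apply: (iffP memv_imgP) => -[x xC].
  by move=> ->; exists x => // i; rewrite lfunE mxE.
move=> yE; exists x => //; rewrite lfunE.
by apply/rowP => i; rewrite mxE -yE.
Qed.

Lemma perm_code1 C : perm_code 1 C = C.
Proof.
apply/vspaceP => y; apply/perm_codeP/idP => [[x xC yE]|yC].
  suff -> : y = x by [].
  by apply/rowP => i; rewrite [LHS]yE invg1 perm1.
by exists y => // i; rewrite invg1 perm1.
Qed.

Lemma perm_codeM s t C : perm_code (s * t) C = perm_code t (perm_code s C).
Proof.
apply/vspaceP => y; apply/perm_codeP/perm_codeP => [[x xC yE]|[x xC yE]].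
  exists (col_perm s^-1 x); last by move=> i; rewrite yE mxE invMg permM.
  by apply/perm_codeP; exists x => // i; rewrite mxE.
have /perm_codeP[z zC xE] := xC.
by exists z => // i; rewrite yE xE invMg permM.
Qed.

Definition Per C : {set 'S_n} := [set s | perm_code s C == C].

Lemma group_set_Per C : group_set (Per C).
Proof.
apply/group_setP; split=> [|s t]; first by rewrite inE perm_code1.
by rewrite !inE perm_codeM => /eqP-> /eqP->.
Qed.

Canonical Per_group C := group (group_set_Per C).

Definition quasi_cyclic (l : nat) C : Prop :=
  (l %| n)%N /\ shift ^+ l \in Per C.

Definition equiv_by s C C' : Prop := C' = perm_code s C.

Definition equiv_codes C C' : Prop := exists s, equiv_by s C C'.

(* As a composite of functions, s * shift ^+ l * s^-1 is
   s^-1 o T^l o s. *)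
Definition Hprime (l : nat) (P : {set 'S_n}) : {set 'S_n} :=
  [set s | s * shift ^+ l * s^-1 \in P].

End Codes.

Arguments shift {n}.

(* The shift i |-> i + l mod n is the l-th power of i |-> i + 1 mod n. *)
Lemma shiftXE n l (i : 'I_n) : (shift ^+ l) i = (i + l) %% n :> nat.
Proof.
elim: l => [|l IHl]; first by rewrite expg0 perm1 addn0 modn_small.
by rewrite expgSr permM permE /= IHl -addn1 modnDml addn1 addnS.
Qed.

(* Main.v *)
(* With permutations composed as functions: if t maps C to C', then
   u = t^-1 T^l t lies in Per C and is conjugate to T^l, which is in P, so u
   generates a p-group. By Sylow, g u g^-1 is in P for some g in Per C, and
   t g^-1 still maps C to C'. *)
Require Import Defs.
Set Implicit Arguments.
Unset Strict Implicit.
Unset Printing Implicit Defensive.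
Import GroupScope GRing.Theory.

Theorem lemma18 (p q l r : nat) (F : finFieldType)
    (hp : prime p)
    (hq : exists p0 k : nat, [/\ prime p0, (0 < k)%N & q = (p0 ^ k)%N])
    (hF : #|F| = q)
    (hl : (0 < l)%N) (hpl : gcdn p l = 1%N) (hpq : gcdn p q = 1%N)
    (C C' : {vspace 'rV[F]_(p ^ r * l)})
    (hC : quasi_cyclic l C) (hC' : quasi_cyclic l C')
    (P : {group 'S_(p ^ r * l)})
    (hP : p.-Sylow(Per C) P)
    (hT : shift ^+ l \in P)
    (hequiv : equiv_codes C C') :
  exists2 s : 'S_(p ^ r * l), s \in Hprime l P & equiv_by s C C'.
Proof.
have [t tC] := hequiv; have [_ TC'] := hC'.
set u := t * shift ^+ l * t^-1.
have uPer : u \in Per C.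
  (* Read left to right, [u] sends [C] to [C'] by [t], stabilizes [C'] since [C'] is quasi-cyclic,
     then returns to [C] by [t^-1]. *)
  move: TC'; rewrite !inE !perm_codeM -tC => /eqP->.
  by rewrite tC -perm_codeM mulgV perm_code1.
have u_p : p.-group <[u]>.
  (* This conjugation takes place in the whole symmetric group and preserves element orders. *)
  have -> : u = (shift ^+ l) ^ t^-1 by rewrite conjgE invgK mulgA.
  by rewrite cycleJ pgroupJ; apply: mem_p_elt (pHall_pgroup hP) hT.
have uPerS : <[u]> \subset Per C by rewrite cycle_subG.
have [g gPer] := Sylow_Jsub hP uPerS u_p.
rewrite -cycleJ cycle_subG => ugP.
(* For this witness, the element that [Hprime] requires in [P] is [g^-1 * u * g], that is
   [u ^ g]. *)
exists (g^-1 * t).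
  by rewrite inE invMg invgK -!mulgA; move: ugP; rewrite conjgE /u !mulgA.
have: g^-1 \in Per C by rewrite groupV.
by rewrite inE /equiv_by perm_codeM => /eqP->.
Qed.
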